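(* Fix a real number $\rho>0$ and integers $N\ge 1$, $M\ge 0$, and let $f(z)=\sum_{j=0}^{N-1}c_jz^j+c'z^M$ be a polynomial with real coefficients. For any vector $\mathbf{d}:=(d_0,\dots,d_{N-1})$ with non-zero entries, let $$\mathcal{C}(\mathbf{d})=\mathcal{C}(\mathbf{d};z^M;N,\rho):=\sum_{j=0}^{N-1}\binom{M}{j}^2\binom{M-j-1}{N-j-1}^2\frac{\rho^{M-j}}{d_j},$$ and let $\mathbf{c}:=(c_0,\dots,c_{N-1})$. The following are equivalent. (1) $f[-]$ preserves positivity on $\mathcal{P}_N(\overline{D}(0,\rho))$. (2) The coefficients $c_j$ satisfy either $c_0,\dots,c_{N-1},c'\ge 0$, or $c_0,\dots,c_{N-1}>0$ and $c'\ge-\mathcal{C}(\mathbf{c})^{-1}$. (3) $f[-]$ preserves positivity on $\mathcal{P}_N^1((0,\rho))$.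
   Context: $\overline{D}(0,\rho)$ is the closed disc in $\mathbb{C}$ with center $0$ and radius $\rho$. For $K\subset\mathbb{C}$, $\mathcal{P}_N(K)$ is the set of positive semidefinite $N\times N$ matrices with all entries in $K$, and $\mathcal{P}_N^1(K)$ is the subset of those of rank at most $1$. For a function $f$ and a matrix $A=(a_{ij})$, $f[A]:=(f(a_{ij}))$ is obtained by applying $f$ entrywise; $f[-]$ preserves positivity on a set of positive semidefinite matrices if $f[A]$ is positive semidefinite for every $A$ in that set. Binomial coefficients are understood as $\binom{z}{n}:=z(z-1)\cdots(z-n+1)/n!$ and $\binom{z}{0}:=1$ for any complex number $z$; with this convention, if $M<N$ then $\mathcal{C}(\mathbf{c};z^M;N,\rho)=c_M^{-1}$.
   Formalization: For M < N the printed equivalence fails (N=1, M=0, c_0=-1, c'=2: f=1 satisfies (1) and (3) but not (2)), so condition (2) gets the extra alternative ''M < N and all coefficients of f are nonnegative''; for M ≥ N it is unchanged. *)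

(* Defs.v *)
From mathcomp Require Import all_boot all_order all_algebra.
From mathcomp Require Import complex.
From mathcomp Require Import classical_sets reals.

Set Implicit Arguments.
Unset Strict Implicit.
Unset Printing Implicit Defensive.

Import Order.TTheory GRing.Theory Num.Theory.
Local Open Scope ring_scope.
Local Open Scope complex_scope.
Local Open Scope sesquilinear_scope.
Local Open Scope classical_set_scope.

Definition psdmx (C : numClosedFieldType) (N : nat) (A : 'M[C]_N) : Prop :=
  A \is hermsymmx /\ forall v : 'rV[C]_N, 0 <= (v *m A *m v ^t*) 0 0.

Definition psd_set (C : numClosedFieldType) (N : nat) (K : set C) :
    set 'M[C]_N :=
  [set A | psdmx A /\ forall i j, K (A i j)].

Definition psd_rank1_set (C : numClosedFieldType) (N : nat) (K : set C) :
    set 'M[C]_N :=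
  [set A | psd_set K A /\ (\rank A <= 1)%N].

Definition preserves_positivity (C : numClosedFieldType) (N : nat)
    (g : C -> C) (S : set 'M[C]_N) : Prop :=
  forall A, S A -> psdmx (map_mx g A).

Definition closed_disc (R : realType) (rho : R) : set R[i] :=
  [set z | `|z| <= rho%:C].

Definition real_interval (R : realType) (rho : R) : set R[i] :=
  [set x%:C | x in [set x : R | 0 < x < rho]].

Definition complex_fun (R : realType) (f : {poly R}) : R[i] -> R[i] :=
  fun z => (map_poly (real_complex R) f).[z].

Definition gbinom (F : numFieldType) (z : F) (n : nat) : F :=
  (\prod_(i < n) (z - i%:R)) / n`!%:R.

(* The upper entry M - j - 1 and the exponent M - j may be negative, so they
   are taken in R and in int; N - j - 1 is a genuine natural number. *)
Definition critC (R : realType) (N M : nat) (rho : R) (d : 'I_N -> R) : R :=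
  \sum_(j < N) gbinom M%:R j ^+ 2
    * gbinom (M%:R - j%:R - 1) (N - j - 1) ^+ 2
    * (rho ^ (M%:Z - j%:Z) / d j).

Definition poly_of (R : realType) (N M : nat) (c : 'I_N -> R) (c' : R) :
    {poly R} :=
  \sum_(j < N) c j *: 'X^j + c' *: 'X^M.

Definition coef_cond (R : realType) (N M : nat) (rho : R) (c : 'I_N -> R)
    (c' : R) : Prop :=
  ((forall j, 0 <= c j) /\ 0 <= c')
  \/ ((forall j, 0 < c j) /\ - (critC M rho c)^-1 <= c').

(* Main.v *)
Require Import Defs.
From mathcomp Require Import all_boot all_order all_algebra.
From mathcomp Require Import complex.
From mathcomp Require Import classical_sets reals.
From mathcomp Require Import polyrcf ring lra zify.

(** Assume first that N <= M. Every root x of a list s of N points satisfies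
    x ^ M = R(x), where R is the remainder of X ^ M modulo the monic polynomial
    with root list s. Up to the sign (-1) ^ (N - 1 - j), the coefficient of X ^ j
    in R is a hook Schur polynomial in s, that is, a polynomial in the entries
    with nonnegative coefficients. The polynomial [hookp] displays this
    positivity, [expr_hookp] is the division identity, and [hookp_nseq] evaluates
    the coefficients at a constant list r, ..., r: the result is
    'C(M, j) * 'C(M - j - 1, N - j - 1) * r ^ (M - j), whose square for
    r = sqrt rho is the numerator of the j-th term of [critC]. By positivity
    these values bound the coefficients for all points of modulus at most r,
    and they are approached by real points increasing to r.

    For a rank one matrix z z^* this settles the matter. With the moments
    w_k = sum_i v_i z_i ^ k, the quadratic form of f[z z^*] at v is
    sum_(k < N) c_k |w_k| ^ 2 + c' |w_M| ^ 2, and w_M is the combination of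
    w_0, ..., w_(N-1) whose coefficients b_k are those of R. The form
    sum_k c_k |w_k| ^ 2 + c' |sum_k b_k w_k| ^ 2 is nonnegative as soon as
    -1 <= c' * sum_k |b_k| ^ 2 / c_k ([perturbed_square_sum_ge0]), and the last
    sum is at most [critC]; this gives [psd_kernel_rank1_poly].

    Conversely, for distinct real points the moments w_0, ..., w_(N-1) take
    arbitrary values because the Vandermonde matrix is invertible
    ([prescribed_moments]), so a form that must be nonnegative on the moments
    is nonnegative everywhere ([hookp_form_ge0]). Unit vectors w and points
    tending to 0 give c_j >= 0; w_k = b_k / c_k and points tending to sqrt rho
    give 1 + c' * critC >= 0.

    Matrices of higher rank are reached by induction on N, following FitzGerald
    and Horn ([psd_kernel_poly_of]). Splitting off a rank one matrix B = z z^*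
    leaves a positive semidefinite D = A - B with vanishing first row and column
    ([schur_pivot]). Along the segment from B to A the derivative of f[B + t D]
    is the entrywise product of D and f'[B + t D]; only its lower block of size
    N - 1 matters, and there f' has the same shape as f with (N, M) replaced by
    (N - 1, M - 1), and with a critical constant satisfying the required
    inequality ([critC_deriv]). So that block is positive semidefinite by
    induction and Schur's product theorem, and f[A] dominates f[B].

    If M < N, then f is a polynomial of degree less than N, the constant is
    1 / c_M, and all conditions say that f has nonnegative coefficients. *)

Set Implicit Arguments.
Unset Strict Implicit.
Unset Printing Implicit Defensive.

Import Order.TTheory GRing.Theory Num.Theory.
Local Open Scope ring_scope.

(** * Hook polynomials and division by a split polynomial *)

(** The complete homogeneous symmetric polynomial of degree m in the entries of
    s; the sum runs over the degree k left to the entries of the tail. *)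
Fixpoint hsym (F : comNzRingType) (s : seq F) (m : nat) : F :=
  if s is u :: s' then \sum_(k < m.+1) u ^+ (m - k) * hsym s' k
  else (m == 0)%:R.

(** The coefficient of X ^ j is the hook Schur polynomial of shape
    (m + 1, 1 ^ (n - 1 - j)) in the n entries of s. The recursion sorts the
    semistandard tableaux by their corner entry: if it is the head u, the first
    row contributes u * hsym (u :: s') m, while the rest of the first column is a
    set of entries of s', hence the coefficients of the product of the X + w. *)
Fixpoint hookp (F : comNzRingType) (m : nat) (s : seq F) : {poly F} :=
  if s is u :: s' then
    (u * hsym s m) *: \prod_(w <- s') ('X + w%:P) + 'X * hookp m s'
  else 0.

Lemma hookpS (F : comNzRingType) m (u : F) s :
  hookp m (u :: s) =
    (u * hsym (u :: s) m) *: \prod_(w <- s) ('X + w%:P) + 'X * hookp m s.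
Proof. by []. Qed.

Section Division.
Variable F : comNzRingType.
Implicit Types (s : seq F) (u x : F).

Lemma hsym0 s : hsym s 0 = 1.
Proof. by elim: s => //= u s IH; rewrite big_ord1 IH mulr1. Qed.

Lemma hsymS u s m : hsym (u :: s) m.+1 = u * hsym (u :: s) m + hsym s m.+1.
Proof.
rewrite /= big_ord_recr /= subnn expr0 mul1r; congr (_ + _).
rewrite big_distrr; apply: eq_bigr => k _.
by rewrite /= subSn ?leq_ord // exprS mulrA.
Qed.

(** The divided difference rule for the polynomials t * hsym (t :: s) m, which
    equal hsym (t :: s) m.+1 up to the term hsym s m.+1 independent of t. *)
Lemma hsym_divdiff x u s m :
  (x - u) * hsym (x :: u :: s) m = x * hsym (x :: s) m - u * hsym (u :: s) m.
Proof.
elim: m => [|m IH]; first by rewrite !hsym0 !mulr1.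
have := hsymS x (u :: s) m; have := hsymS u s m; have := hsymS x s m.
move: (hsym _ m.+1) (hsym _ m.+1) (hsym _ m.+1) (hsym _ m.+1) IH.
move: (hsym _ m) (hsym _ m) (hsym _ m) => a b c d e f g IH.
move=> -> -> ->.
by rewrite mulrDr mulrCA IH; ring.
Qed.

(** Euclidean division of X ^ (m + n) by the monic polynomial with root list s,
    evaluated at x: the quotient takes the value hsym (x :: s) m. Evaluating
    [hookp] at - x restores the alternating signs of the remainder. *)
Lemma expr_hookp m s x :
  x ^+ (m + size s) = hsym (x :: s) m * \prod_(w <- s) (x - w)
                      - (-1) ^+ size s * (hookp m s).[- x].
Proof.
elim: s => [|u s IH].
  rewrite big_nil hornerC mulr0 subr0 mulr1 addn0 /= big_ord_recl /= subn0.
  by rewrite mulr1 big1 ?addr0 // => i _; rewrite mulr0.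
rewrite [size _]/= addnS exprS IH big_cons.
have -> : (hookp m (u :: s)).[- x] =
   u * hsym (u :: s) m * ((-1) ^+ size s * \prod_(w <- s) (x - w))
   - x * (hookp m s).[- x].
  rewrite hookpS hornerD hornerZ hornerM hornerX horner_prod mulNr; congr (_ * _ - _).
  elim: (s) => [|w r IHr]; first by rewrite !big_nil mul1r.
  by rewrite !big_cons IHr /= hornerD hornerX hornerC exprS; ring.
have sgn2 : (-1) ^+ size s * (-1) ^+ size s = 1 :> F.
  by rewrite -exprD addnn -mul2n exprM sqrrN expr1n expr1n.
have := hsym_divdiff x u s m.
move: sgn2; rewrite exprS.
move: (hsym (x :: u :: s) m) (hsym (x :: s) m) (hsym (u :: s) m) => a b d.
move: (\prod_(_ <- _) _) (hookp _ _).[_] ((-1) ^+ _) => p q e e2 E.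
transitivity (x * b * p - x * (e * q)); first by ring.
transitivity ((x * b - u * d) * p + (e * e) * (u * d * p) - x * (e * q)).
  by rewrite e2; ring.
by rewrite -E; ring.
Qed.

Lemma size_hookp m s : (size (hookp m s) <= size s)%N.
Proof.
elim: s => [|u s IH] /=; first by rewrite size_poly0.
apply: (leq_trans (size_polyD _ _)); rewrite geq_max; apply/andP; split.
  apply: (leq_trans (size_scale_leq _ _)).
  rewrite (eq_bigr (fun w => 'X - (- w)%:P)) ?size_prod_XsubC // => w _.
  by rewrite polyCN opprK.
rewrite mulrC; apply: (leq_trans (size_polyMleq _ _)).
by rewrite size_polyX addn2.
Qed.

End Division.

Section Bounds.
Variable F : numDomainType.
Implicit Types (s t : seq F) (a : F).

(** Polynomials with nonnegative coefficients, such as the three families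
    treated below, are monotone for this relation. *)
Definition dominated s t := all2 (fun w r : F => `|w| <= r) s t.

Lemma dominated_nseq s a :
  {in s, forall w, `|w| <= a} -> dominated s (nseq (size s) a).
Proof.
elim: s => //= w s IH le_sa; rewrite le_sa ?mem_head //=.
by apply: IH => x xs; rewrite le_sa // in_cons xs orbT.
Qed.

Lemma nseq_dominated s a : 0 <= a ->
  {in s, forall w, a <= w} -> dominated (nseq (size s) a) s.
Proof.
move=> a0; elim: s => //= w s IH le_as; rewrite ger0_norm // le_as ?mem_head //=.
by apply: IH => x xs; rewrite le_as // in_cons xs orbT.
Qed.

Lemma hsym_dominated s t m : dominated s t -> `|hsym s m| <= hsym t m.
Proof.
elim: s t m => [|w s IH] [|r t] //= m; first by rewrite normr_nat.
case/andP=> wr st; apply: (le_trans (ler_norm_sum _ _ _)); apply: ler_sum => k _.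
by rewrite normrM normrX ler_pM ?exprn_ge0 ?IH // lerXn2r ?nnegrE ?(le_trans _ wr).
Qed.

Lemma coefXDCM w (p : {poly F}) j :
  (('X + w%:P) * p)`_j = (if j is i.+1 then p`_i else 0) + w * p`_j.
Proof. by rewrite mulrDl coefD coefXM coefCM; case: j. Qed.

Lemma prodXDC_dominated s t j : dominated s t ->
  `|(\prod_(w <- s) ('X + w%:P))`_j| <= (\prod_(w <- t) ('X + w%:P))`_j.
Proof.
elim: s t j => [|w s IH] [|r t] // j.
  by rewrite !big_nil coef1 normr_nat.
case/andP=> wr st; rewrite !big_cons !coefXDCM.
apply: (le_trans (ler_normD _ _)); apply: lerD.
  by case: j => [|j]; rewrite ?normr0 ?IH.
by rewrite normrM ler_pM ?IH.
Qed.

Lemma hookp_dominated m s t j : dominated s t ->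
  `|(hookp m s)`_j| <= (hookp m t)`_j.
Proof.
elim: s t j => [|w s IH] [|r t] // j; first by rewrite coef0 normr0.
move=> /[dup] wsrt /andP[wr st].
rewrite !hookpS !coefD !coefZ !coefXM.
apply: (le_trans (ler_normD _ _)); apply: lerD.
  rewrite !normrM ler_pM ?mulr_ge0 ?prodXDC_dominated //.
  by rewrite ler_pM ?hsym_dominated.
by case: (j == 0)%N; rewrite ?normr0 ?IH.
Qed.

End Bounds.

(** The value at 1, ..., 1 (N times) of the hook Schur polynomial which is the
    coefficient of X ^ j in [hookp]; see [hookp_nseq]. *)
Definition hookdim (N M j : nat) : nat := 'C(M, j) * 'C(M - j - 1, N - j - 1).

Lemma hookdim_gt0 N M k : (k < N)%N -> (N <= M)%N -> (0 < hookdim N M k)%N.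
Proof.
by move=> kN NM; rewrite muln_gt0 !bin_gt0; apply/andP; split; lia.
Qed.

(** Counts the pairs K included in L, of sizes k and n, inside a set of size N
    by choosing L first or K first. *)
Lemma bin_mul_subset N n k : (k <= n)%N -> (n <= N)%N ->
  ('C(N, n) * 'C(n, k) = 'C(N, k) * 'C(N - k, n - k))%N.
Proof.
move=> kn nN; have kN := leq_trans kn nN.
have fact0 : (0 < k`! * (n - k)`! * (N - n)`!)%N by rewrite !muln_gt0 !fact_gt0.
apply/eqP; rewrite -(eqn_pmul2r fact0); apply/eqP.
have E : (N - n = (N - k) - (n - k))%N by lia.
have := bin_fact nN; have := bin_fact kn; have := bin_fact kN.
have : (n - k <= N - k)%N by lia.
by move/bin_fact; rewrite -E => <- <- <-; nia.
Qed.

Section ConstantSequence.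
Variables (F : comNzRingType) (a : F).

Lemma hsym_nseq n m : hsym (nseq n.+1 a) m = 'C(m + n, n)%:R * a ^+ m.
Proof.
elim: n m => [|n IHn] m.
  rewrite bin0 mul1r /= big_ord_recl /= subn0 mulr1 big1 ?addr0 // => i _.
  by rewrite mulr0.
elim: m => [|m IHm]; first by rewrite hsym0 binn mulr1.
rewrite -[nseq _ _]/(a :: nseq n.+1 a) hsymS -[a :: _]/(nseq n.+2 a) IHm IHn.
by rewrite [in RHS]addSn [in RHS]binS (addSnnS m n) natrD exprS; ring.
Qed.

Lemma prodXDC_nseq n j :
  (\prod_(w <- nseq n a) ('X + w%:P))`_j = 'C(n, j)%:R * a ^+ (n - j).
Proof.
elim: n j => [|n IH] j.
  by rewrite big_nil coef1; case: j => [|j]; rewrite ?mulr1 ?mul0r.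
rewrite big_cons mulrDl coefD coefXM coefCM !IH.
case: j => [|j] /=; first by rewrite !bin0 !subn0 exprS; ring.
rewrite binS natrD subSS; case: (ltnP j n) => jn.
  have -> : (n - j = (n - j.+1).+1)%N by rewrite subnSK.
  by rewrite exprS; ring.
by rewrite (@bin_small n j.+1) //; ring.
Qed.

(** The recursion of [hookp] becomes Pascal's rule for 'C(m + n, j), once
    [bin_mul_subset] has extracted the common factor. *)
Lemma hookp_nseq m n j : (j < n)%N ->
  (hookp m (nseq n a))`_j = (hookdim n (m + n) j)%:R * a ^+ (m + n - j).
Proof.
elim: n j => // n IH j; rewrite ltnS => jn.
rewrite -[nseq _ _]/(a :: nseq n a) hookpS -[a :: _]/(nseq n.+1 a) hsym_nseq.
rewrite coefD coefZ prodXDC_nseq coefXM /hookdim.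
case: j jn => [|j] jn.
  rewrite !bin0 !subn0 !subn1 !addnS /= addr0 exprS exprD.
  by ring.
rewrite IH //= /hookdim.
have ->: (n.+1 - j.+1 - 1 = n - j.+1)%N by lia.
have ->: (m + n.+1 - j.+1 - 1 = m + n - j.+1)%N by lia.
have ->: (m + n - j - 1 = m + n - j.+1)%N by lia.
have ->: (m + n.+1 - j.+1 = n - j.+1 + m.+1)%N by lia.
have ->: (m + n - j = n - j.+1 + m.+1)%N by lia.
rewrite (addnS m n) binS mulnDl natrD -bin_mul_subset; [|lia..].
by rewrite !natrM exprD exprS; ring.
Qed.
End ConstantSequence.

(** * The critical constant in binomial form *)

Section CriticalConstant.
Variable F : numFieldType.

Lemma gbinom_nat n k : gbinom (n%:R : F) k = 'C(n, k)%:R.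
Proof.
have ff : \prod_(i < k) (n%:R - i%:R : F) = (n ^_ k)%:R.
  elim: k => [|k IH]; first by rewrite big_ord0.
  rewrite big_ord_recr /= IH ffactnSr natrM.
  case: (leqP k n) => kn; first by rewrite natrB.
  by rewrite ffact_small // !mul0r.
by rewrite /gbinom ff -bin_ffact natrM mulfK // pnatr_eq0 -lt0n fact_gt0.
Qed.

Lemma gbinomN1_sqr k : gbinom (-1 : F) k ^+ 2 = 1.
Proof.
have ff : \prod_(i < k) (-1 - i%:R : F) = (-1) ^+ k * k`!%:R.
  elim: k => [|k IH]; first by rewrite big_ord0 mul1r.
  by rewrite big_ord_recr /= IH factS natrM exprS -natr1; ring.
rewrite /gbinom ff mulfK ?pnatr_eq0 -?lt0n ?fact_gt0 //.
by rewrite -exprM mulnC exprM sqrrN expr1n expr1n.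
Qed.

End CriticalConstant.

Lemma critC_hookdim (R : realType) (N M : nat) (rho : R) (d : 'I_N -> R) :
  (N <= M)%N ->
  critC M rho d = \sum_(j < N) (hookdim N M j)%:R ^+ 2 * rho ^+ (M - j) / d j.
Proof.
move=> NM; apply: eq_bigr => j _.
have jM : (j < M)%N by exact: leq_trans (ltn_ord j) NM.
have -> : M%:R - j%:R - 1 = (M - j - 1)%:R :> R.
  by rewrite !natrB ?subn_gt0 // ltnW.
rewrite !gbinom_nat /hookdim natrM exprMn mulrA.
by rewrite subzn ?(ltnW jM).
Qed.

(** Only the term j = M survives: for j > M the first binomial vanishes, for
    j < M the second one does, and at j = M the upper entry of the second one
    is -1. *)
Lemma critC_small (R : realType) (N M : nat) (rho : R) (d : 'I_N -> R)
  (MN : (M < N)%N) : critC M rho d = (d (Ordinal MN))^-1.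
Proof.
rewrite /critC (bigD1 (Ordinal MN)) //= big1 => [|j jM].
  rewrite gbinom_nat binn subrr sub0r gbinomN1_sqr subrr expr0z.
  by rewrite expr1n !mul1r addr0.
rewrite gbinom_nat; case: (ltngtP j M) => [jltM|Mj|jE].
- have -> : M%:R - j%:R - 1 = (M - j - 1)%:R :> R.
    by rewrite !natrB ?subn_gt0 // ltnW.
  rewrite gbinom_nat (@bin_small (M - j - 1)) ?expr0n ?mulr0 ?mul0r //.
  by lia.
- by rewrite bin_small // expr0n !mul0r.
by case/eqP: jM; apply: val_inj.
Qed.

(** * Positive semidefinite kernels on a finite index set *)

Section Kernels.
Variable C : numClosedFieldType.

Definition qform n (A : 'I_n -> 'I_n -> C) (v : 'I_n -> C) : C :=
  \sum_i \sum_j v i * A i j * (v j)^*.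

(** Kernels are plain functions rather than matrices, so that entrywise
    operations and restrictions to fewer indices are written directly. *)
Definition psd_kernel n (A : 'I_n -> 'I_n -> C) : Prop :=
  (forall i j, A j i = (A i j)^*) /\ forall v, 0 <= qform A v.

Lemma psdmx_kernel n (A : 'M[C]_n) : psdmx A <-> psd_kernel A.
Proof.
have qE (v : 'rV[C]_n) : (v *m A *m (map_mx Num.conj v)^T) 0 0 = qform A (v 0).
  rewrite mxE /qform exchange_big /=; apply: eq_bigr => j _.
  by rewrite !mxE mulr_suml.
split=> [[/is_hermitianmxP hA pA]|[hA pA]]; split.
- by move=> i j; rewrite {1}hA expr0 scale1r !mxE.
- move=> v; have := pA (\row_j v j).
  rewrite -map_trmx qE; congr (_ <= _); apply: eq_bigr => i _.
  by apply: eq_bigr => j _; rewrite !mxE.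
- apply/is_hermitianmxP/matrixP => i j; rewrite expr0 scale1r !mxE.
  exact: hA.
by move=> v; rewrite -map_trmx qE.
Qed.

Lemma eq_psd_kernel n (A B : 'I_n -> 'I_n -> C) :
  (forall i j, A i j = B i j) -> psd_kernel A -> psd_kernel B.
Proof.
move=> AB [hA pA]; split=> [i j|v]; first by rewrite -!AB.
have := pA v; congr (_ <= _); apply: eq_bigr => i _.
by apply: eq_bigr => j _; rewrite AB.
Qed.

Lemma qformD n (A B : 'I_n -> 'I_n -> C) v :
  qform (fun i j => A i j + B i j) v = qform A v + qform B v.
Proof.
rewrite -big_split; apply: eq_bigr => i _ /=; rewrite -big_split.
by apply: eq_bigr => j _ /=; rewrite mulrDr mulrDl.
Qed.

Lemma qformZ n (A : 'I_n -> 'I_n -> C) a v :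
  qform (fun i j => a * A i j) v = a * qform A v.
Proof.
rewrite mulr_sumr; apply: eq_bigr => i _; rewrite mulr_sumr.
by apply: eq_bigr => j _; rewrite !mulrA [v i * a]mulrC.
Qed.

Lemma qform_rank1 n (z v : 'I_n -> C) :
  qform (fun i j => z i * (z j)^*) v = `|\sum_i v i * z i| ^+ 2.
Proof.
rewrite normCK rmorph_sum mulr_suml; apply: eq_bigr => i _.
rewrite mulr_sumr; apply: eq_bigr => j _.
by rewrite rmorphM /=; ring.
Qed.

Lemma psd_kernelD n (A B : 'I_n -> 'I_n -> C) :
  psd_kernel A -> psd_kernel B -> psd_kernel (fun i j => A i j + B i j).
Proof.
move=> [hA pA] [hB pB]; split=> [i j|v]; first by rewrite rmorphD /= hA hB.
by rewrite qformD addr_ge0.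
Qed.

Lemma psd_kernelZ n (A : 'I_n -> 'I_n -> C) a :
  0 <= a -> psd_kernel A -> psd_kernel (fun i j => a * A i j).
Proof.
move=> a0 [hA pA]; split=> [i j|v].
  by rewrite rmorphM /= hA (geC0_conj a0).
by rewrite qformZ mulr_ge0.
Qed.

Lemma psd_kernel_rank1 n (z : 'I_n -> C) :
  psd_kernel (fun i j => z i * (z j)^*).
Proof.
split=> [i j|v]; first by rewrite rmorphM /= conjCK mulrC.
by rewrite qform_rank1 exprn_ge0.
Qed.

Lemma psd_kernel_lift n (A : 'I_n.+1 -> 'I_n.+1 -> C) : psd_kernel A ->
  psd_kernel (fun i j => A (lift ord0 i) (lift ord0 j)).
Proof.
move=> [hA pA]; split=> [i j|v]; first exact: hA.
pose w k := if unlift ord0 k is Some i then v i else 0.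
have w0 : w ord0 = 0 by rewrite /w unlift_none.
have wS i : w (lift ord0 i) = v i by rewrite /w liftK.
have := pA w; congr (_ <= _); rewrite /qform big_ord_recl big1 ?add0r.
  apply: eq_bigr => i _; rewrite big_ord_recl w0 conjC0 mulr0 add0r.
  by apply: eq_bigr => j _; rewrite !wS.
by move=> j _; rewrite w0 !mul0r.
Qed.

Lemma psd_diag_ge0 n (A : 'I_n -> 'I_n -> C) i : psd_kernel A -> 0 <= A i i.
Proof.
case=> _ /(_ (fun k => (k == i)%:R)); congr (_ <= _); rewrite /qform.
rewrite (bigD1 i) //= [X in _ + X]big1 ?addr0 => [|k ki]; last first.
  by rewrite big1 // => j _; rewrite (negPf ki) !mul0r.
rewrite (bigD1 i) //= big1 ?addr0 => [|k ki]; last first.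
  by rewrite (negPf ki) conjC0 mulr0.
by rewrite eqxx conjC1 mul1r mulr1.
Qed.

(** Completing the square in the first coordinate, used to minimise the form
    along the first basis vector. *)
Lemma qform_shift n (A : 'I_n.+1 -> 'I_n.+1 -> C) v x :
  (forall i j, A j i = (A i j)^*) ->
  let L := \sum_i v i * A i ord0 in
  qform A (fun i => v i + x * (i == ord0)%:R) =
  qform A v + x^* * L + x * L^* + `|x| ^+ 2 * A ord0 ord0.
Proof.
move=> hA L; rewrite /qform.
have delta (G : 'I_n.+1 -> C) : \sum_i G i * (i == ord0)%:R = G ord0.
  rewrite (bigD1 ord0) //= mulr1 big1 ?addr0 // => i /negPf ->.
  by rewrite mulr0.
have inner (u : C) i : \sum_j u * A i j * (v j + x * (j == ord0)%:R)^* =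
   u * (\sum_j A i j * (v j)^* + x^* * A i ord0).
  rewrite mulrDr -(delta (fun j => u * (x^* * A i j))) mulr_sumr -big_split.
  apply: eq_bigr => j _ /=; rewrite rmorphD rmorphM /= rmorph_nat; ring.
under eq_bigr => i _ do rewrite inner mulrDl.
rewrite big_split /=; under [X in _ + X]eq_bigr => i _ do
  rewrite -mulrA [_%:R * _]mulrC mulrA.
rewrite delta mulrDr normCK.
have -> : \sum_j A ord0 j * (v j)^* = L^*.
  rewrite rmorph_sum; apply: eq_bigr => j _.
  by rewrite rmorphM /= -hA mulrC.
have -> : \sum_i v i * (\sum_j A i j * (v j)^* + x^* * A i ord0) =
  \sum_i \sum_j v i * A i j * (v j)^* + x^* * L.
  rewrite mulr_sumr -big_split; apply: eq_bigr => i _ /=.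
  rewrite mulrDr mulr_sumr; congr (_ + _); last by ring.
  by apply: eq_bigr => j _; rewrite mulrA.
by ring.
Qed.

(** The first step of a Cholesky factorisation. If the corner entry vanishes,
    then so does the whole first column and z = 0 works; otherwise z is the first
    column divided by the square root of the corner entry, and the form of the
    Schur complement at v is the minimum of the original form over the first
    coordinate. *)
Lemma schur_pivot n (A : 'I_n.+1 -> 'I_n.+1 -> C) : psd_kernel A ->
  exists z : 'I_n.+1 -> C,
    (forall i, A i ord0 = z i * (z ord0)^*) /\
    psd_kernel (fun i j => A i j - z i * (z j)^*).
Proof.
move=> pA; have [hA qA] := pA; have a0 := psd_diag_ge0 ord0 pA.
have [a00|an0] := eqVneq (A ord0 ord0) 0.
  (* a nonzero L would make the form negative at v - k * L * e_0 for large k *)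
  have L0 v : \sum_i v i * A i ord0 = 0.
    apply/eqP; apply/negPn/negP => Ln0; set L := \sum_i _ in Ln0.
    have nL : 0 < `|L| ^+ 2 by rewrite exprn_gt0 // normr_gt0.
    pose k := (qform A v + 1) / `|L| ^+ 2.
    have k0 : 0 <= k by rewrite divr_ge0 ?addr_ge0 // ltW.
    have := qA (fun i => v i + (- k * L) * (i == ord0)%:R).
    rewrite qform_shift // -/L a00 mulr0 addr0 rmorphM /= rmorphN /= geC0_conj //.
    rewrite -addrA.
    have -> : - k * L^* * L + - k * L * L^* = - (k * `|L| ^+ 2) *+ 2.
      by rewrite normCK; ring.
    rewrite /k divfK ?gt_eqF // => /(lt_le_trans _) H.
    have /H : - (qform A v + 2) < 0 by rewrite oppr_lt0 ltr_wpDl.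
    have -> : qform A v + - (qform A v + 1) *+ 2 = - (qform A v + 2) by ring.
    by rewrite ltxx.
  exists (fun=> 0); split=> [i|].
    rewrite mul0r -(L0 (fun j => (j == i)%:R)) (bigD1 i) //= eqxx mul1r.
    by rewrite big1 ?addr0 // => j /negPf ->; rewrite mul0r.
  by apply: eq_psd_kernel pA => i j; rewrite mul0r subr0.
have ap : 0 < A ord0 ord0 by rewrite lt_def an0.
pose s := sqrtC (A ord0 ord0).
have sp : 0 < s by rewrite sqrtC_gt0.
have sq : s * s = A ord0 ord0 by rewrite -expr2 sqrtCK.
have sc : s^* = s by rewrite geC0_conj // ltW.
have sn0 : s != 0 by rewrite gt_eqF.
exists (fun i => A i ord0 / s); split=> [i|].
  by rewrite -sq mulfK // sc divfK.
split=> [i j|v].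
  rewrite rmorphB /= -hA; congr (_ - _).
  by rewrite [RHS]rmorphM /= conjCK mulrC.
set L := \sum_i v i * A i ord0.
(* the minimum along the first coordinate is attained at - L / A 0 0 *)
have := qA (fun i => v i + (- L / A ord0 ord0) * (i == ord0)%:R).
rewrite qform_shift // -/L; congr (_ <= _).
have -> : qform (fun i j => A i j - A i ord0 / s * (A j ord0 / s)^*) v =
  qform A v - `|\sum_i v i * (A i ord0 / s)| ^+ 2.
  rewrite -qform_rank1 -[X in _ + X]mulN1r -qformZ -qformD.
  by apply: eq_bigr => i _; apply: eq_bigr => j _; rewrite mulN1r.
have -> : \sum_i v i * (A i ord0 / s) = L / s.
  by rewrite mulr_suml; apply: eq_bigr => i _; rewrite mulrA.
rewrite !normCK rmorphM /= fmorphV /= rmorphM /= rmorphN /= fmorphV /=.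
rewrite sc (geC0_conj a0) -sq; field.
by rewrite sn0.
Qed.

Lemma qform_bordered n (A : 'I_n.+1 -> 'I_n.+1 -> C) v :
  (forall i, A i ord0 = 0) -> (forall i, A ord0 i = 0) ->
  qform A v = qform (fun i j => A (lift ord0 i) (lift ord0 j))
                    (fun i => v (lift ord0 i)).
Proof.
move=> c0 r0; rewrite /qform big_ord_recl big1 ?add0r => [|j _]; last first.
  by rewrite r0 mulr0 mul0r.
apply: eq_bigr => i _; rewrite big_ord_recl c0 mulr0 mul0r add0r.
by [].
Qed.

(** Write A = z z^* + D as in [schur_pivot]. The entrywise product of z z^*
    with B is B rescaled by z, and that of D with B lives on one index less. *)
Theorem schur_product n (A B : 'I_n -> 'I_n -> C) :
  psd_kernel A -> psd_kernel B -> psd_kernel (fun i j => A i j * B i j).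
Proof.
elim: n A B => [|n IH] A B pA pB.
  by split=> [[]|v] //; rewrite /qform big_ord0.
split=> [i j|v]; first by rewrite rmorphM /= (proj1 pA i j) (proj1 pB i j).
have [z [Az pD]] := schur_pivot pA; set D := (fun i j => _ - _) in pD.
have Dc i : D i ord0 = 0 by rewrite /D Az subrr.
have Dr i : D ord0 i = 0 by rewrite (proj1 pD i ord0) Dc conjC0.
have -> : qform (fun i j => A i j * B i j) v =
  qform B (fun i => v i * z i) + qform (fun i j => D i j * B i j) v.
  rewrite /qform -big_split; apply: eq_bigr => i _ /=; rewrite -big_split.
  by apply: eq_bigr => j _ /=; rewrite /D rmorphM /=; ring.
apply: addr_ge0; first exact: (proj2 pB).
rewrite qform_bordered => [|i|i]; rewrite ?Dc ?Dr ?mul0r //.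
by apply: (proj2 (IH _ _ _ _)); exact: psd_kernel_lift.
Qed.

Lemma psd_kernelX n (A : 'I_n -> 'I_n -> C) k :
  psd_kernel A -> psd_kernel (fun i j => A i j ^+ k).
Proof.
move=> pA; elim: k => [|k IH].
  apply: eq_psd_kernel (psd_kernel_rank1 (fun=> 1)) => i j.
  by rewrite expr0 mul1r conjC1.
by apply: eq_psd_kernel (schur_product pA IH) => i j; rewrite exprS.
Qed.

Lemma psd_kernel_sum n m (A : 'I_m -> 'I_n -> 'I_n -> C) :
  (forall k, psd_kernel (A k)) -> psd_kernel (fun i j => \sum_k A k i j).
Proof.
elim: m A => [|m IH] A pA.
  apply: eq_psd_kernel (psd_kernel_rank1 (fun=> 0)) => i j.
  by rewrite mul0r big_ord0.
apply: eq_psd_kernel (psd_kernelD (IH _ (fun k => pA (widen_ord (leqnSn m) k)))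
  (pA ord_max)) => i j.
by rewrite big_ord_recr.
Qed.

End Kernels.

(** * Sufficiency on rank one matrices *)

(** With B = sum_k b_k w_k, this is the part of the Cauchy-Schwarz inequality
    |B| ^ 2 <= (sum_k |b_k| ^ 2 / c_k) (sum_k c_k |w_k| ^ 2) that is needed for a
    negative perturbation c'. *)
Lemma perturbed_square_sum_ge0 (C : numClosedFieldType) N
    (c b w : 'I_N -> C) (c' : C) :
  (forall k, 0 < c k) -> c' <= 0 -> -1 <= c' * \sum_k `|b k| ^+ 2 / c k ->
  0 <= \sum_k c k * `|w k| ^+ 2 + c' * `|\sum_k b k * w k| ^+ 2.
Proof.
move=> c0 c'0 cK; set B := \sum_k b k * w k.
have c'c : c'^* = c' by rewrite conj_Creal ?ler0_real.
(* shifting w_k by the multiple c' B of the extremal vector gives a bound that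
   needs no division by sum_k |b_k| ^ 2 / c_k *)
have : 0 <= \sum_k c k * `|w k + c' * ((b k)^* / c k) * B| ^+ 2.
  by apply: sumr_ge0 => k _; rewrite mulr_ge0 ?exprn_ge0 // ltW.
have -> : \sum_k c k * `|w k + c' * ((b k)^* / c k) * B| ^+ 2 =
  \sum_k c k * `|w k| ^+ 2 + c' * `|B| ^+ 2 + c' * `|B| ^+ 2
  + c' * (c' * \sum_k `|b k| ^+ 2 / c k) * `|B| ^+ 2.
  have E k : c k * `|w k + c' * ((b k)^* / c k) * B| ^+ 2 =
    c k * `|w k| ^+ 2 + c' * B^* * (b k * w k) + c' * B * (b k * w k)^* +
    c' * c' * `|B| ^+ 2 * (`|b k| ^+ 2 / c k).
    rewrite !normCK rmorphD !rmorphM /= conjCK fmorphV /= c'c.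
    rewrite (geC0_conj (ltW (c0 k))); field.
    by rewrite gt_eqF.
  rewrite (eq_bigr _ (fun k _ => E k)) !big_split /= -!mulr_sumr -rmorph_sum /= -/B.
  by rewrite normCK; ring.
move/le_trans; apply; rewrite -addrA gerDl -mulrDl.
rewrite mulr_le0_ge0 ?exprn_ge0 // -[X in X + _]mulr1 -mulrDr.
by rewrite mulr_le0_ge0 // -lerBlDl sub0r.
Qed.

(** Every z_i is a root of the divisor in [expr_hookp], so the moment of order
    m + N is a fixed combination of the first N moments. *)
Lemma power_sum_hookp (F : idomainType) N m (v z : 'I_N -> F) :
  let s := [seq z i | i <- enum 'I_N] in
  \sum_i v i * z i ^+ (m + N) = - (-1) ^+ N *
    \sum_(k < N) (hookp m s)`_k * (-1) ^+ k * \sum_i v i * z i ^+ k.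
Proof.
move=> s; have sz : size s = N by rewrite size_map size_enum_ord.
under [in RHS]eq_bigr => k _ do rewrite mulr_sumr.
rewrite exchange_big mulr_sumr; apply: eq_bigr => i _ /=.
have zs : z i \in s by apply: map_f; rewrite mem_enum.
have := expr_hookp m s (z i); rewrite sz => ->.
have -> : \prod_(x <- s) (z i - x) = 0.
  apply/eqP; rewrite prodf_seq_eq0; apply/hasP.
  by exists (z i); rewrite ?subrr /=.
rewrite mulr0 sub0r (horner_coef_wide _ (leq_trans (size_hookp m s) (eq_leq sz))).
rewrite -mulNr mulrCA !mulr_sumr; apply: eq_bigr => k _.
by rewrite (exprNn (z i)); ring.
Qed.

Local Open Scope complex_scope.

Section Sufficiency.
Variable R : realType.
Implicit Types (p : {poly R}) (rho : R).
Notation C := (R[i]).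

Lemma complex_funE p (z : C) :
  complex_fun p z = \sum_(k < size p) (p`_k)%:C * z ^+ k.
Proof.
rewrite /complex_fun horner_coef size_map_poly.
by apply: eq_bigr => k _; rewrite coef_map.
Qed.

Lemma complex_fun_poly_of N M (c : 'I_N -> R) c' (z : C) :
  complex_fun (poly_of M c c') z =
    \sum_(k < N) (c k)%:C * z ^+ k + c'%:C * z ^+ M.
Proof.
rewrite /complex_fun /poly_of rmorphD rmorph_sum /= hornerD horner_sum.
congr (_ + _); last by rewrite map_polyZ map_polyXn hornerZ hornerXn.
by apply: eq_bigr => k _; rewrite map_polyZ map_polyXn hornerZ hornerXn.
Qed.

Lemma psd_kernel_nonneg_coef n p (A : 'I_n -> 'I_n -> C) :
  (forall k, 0 <= p`_k) -> psd_kernel A ->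
  psd_kernel (fun i j => complex_fun p (A i j)).
Proof.
move=> p0 pA.
have pk (k : 'I_(size p)) : psd_kernel (fun i j => (p`_k)%:C * A i j ^+ k).
  by apply: psd_kernelZ; [rewrite ler0c | exact: psd_kernelX].
by apply: eq_psd_kernel (psd_kernel_sum pk) => i j; rewrite complex_funE.
Qed.

Lemma conj_real_complex (x : R) : Num.conj (x%:C) = x%:C.
Proof. by rewrite conj_Creal // complex_real. Qed.

Lemma complex_fun_conj p (z : C) :
  complex_fun p (Num.conj z) = Num.conj (complex_fun p z).
Proof.
rewrite !complex_funE rmorph_sum; apply: eq_bigr => k _.
by rewrite rmorphM rmorphXn /= conj_real_complex.
Qed.

(** The bound |z_i| <= sqrt rho makes the coefficients b_k of the moment
    relation at most those of the constant list, whence sum_k |b_k| ^ 2 / c_k is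
    at most the critical constant. *)
Lemma psd_kernel_rank1_poly N m (c : 'I_N -> R) (c' rho : R) (z : 'I_N -> C) :
  0 <= rho -> (forall j, 0 < c j) -> -1 <= c' * critC (m + N) rho c ->
  (forall i, `|z i| ^+ 2 <= rho%:C) ->
  psd_kernel (fun i j =>
    complex_fun (poly_of (m + N) c c') (z i * Num.conj (z j))).
Proof.
move=> rho0 c0 cK zrho; have pz := psd_kernel_rank1 z.
have [c'0|c'0] := leP 0 c'.
  apply: psd_kernel_nonneg_coef => // k.
  rewrite /poly_of coefD coef_sum coefZ coefXn addr_ge0 ?mulr_ge0 ?ler0n //.
  by rewrite sumr_ge0 // => j _; rewrite coefZ coefXn mulr_ge0 ?ler0n // ltW.
split=> [i j|v].
  by rewrite -complex_fun_conj rmorphM /= conjCK mulrC.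
pose w k := \sum_i v i * z i ^+ k.
have -> : qform (fun i j =>
    complex_fun (poly_of (m + N) c c') (z i * Num.conj (z j))) v =
  \sum_k (c k)%:C * `|w k| ^+ 2 + c'%:C * `|w (m + N)%N| ^+ 2.
  have wE k : `|w k| ^+ 2 = qform (fun i j => (z i * Num.conj (z j)) ^+ k) v.
    rewrite -qform_rank1; apply: eq_bigr => i _; apply: eq_bigr => j _.
    by rewrite exprMn rmorphXn.
  rewrite wE -qformZ.
  rewrite (eq_bigr (fun k : 'I_N => qform (fun i j =>
     (c k)%:C * (z i * Num.conj (z j)) ^+ k) v)); last first.
    by move=> k _; rewrite wE qformZ.
  rewrite /qform [X in _ = X + _]exchange_big -big_split; apply: eq_bigr => i _ /=.
  rewrite [X in _ = X + _]exchange_big -big_split; apply: eq_bigr => j _ /=.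
  rewrite complex_fun_poly_of mulrDr mulrDl mulr_sumr mulr_suml.
  by congr (_ + _).
pose s := [seq z i | i <- enum 'I_N].
have sz : size s = N by rewrite size_map size_enum_ord.
pose b k := - (-1) ^+ N * (hookp m s)`_k * (-1) ^+ k.
have wb : w (m + N)%N = \sum_(k < N) b k * w k.
  rewrite /w power_sum_hookp mulr_sumr; apply: eq_bigr => k _.
  by rewrite /b !mulrA.
rewrite wb; apply: perturbed_square_sum_ge0 => [k||].
- by rewrite ltcR c0.
- by rewrite lecR ltW.
have bK : \sum_(k < N) `|b k| ^+ 2 / (c k)%:C <= (critC (m + N) rho c)%:C.
  rewrite critC_hookdim ?leq_addl // rmorph_sum; apply: ler_sum => k _.
  rewrite rmorphM fmorphV /= ler_pM2r ?invr_gt0 ?ltcR //.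
  pose r : R := Num.sqrt rho.
  have : `|b k| <= (hookdim N (m + N) k)%:R * r%:C ^+ (m + N - k).
    rewrite /b !normrM normrN !normrX normrN1 !expr1n mul1r mulr1.
    rewrite -hookp_nseq //; apply: hookp_dominated.
    rewrite -[X in nseq X _]sz; apply: dominated_nseq => _ /mapP[i _ ->].
    have rr : r%:C ^+ 2 = rho%:C.
      by rewrite -[LHS](rmorphXn (real_complex R)) sqr_sqrtr.
    rewrite -(@ler_pXn2r _ 2) ?nnegrE ?normr_ge0 ?ler0c ?sqrtr_ge0 //.
    by rewrite rr.
  move=> bk; rewrite -(sqr_sqrtr rho0) -/r -exprM mulnC exprM -exprMn.
  rewrite rmorphXn rmorphM rmorphXn rmorph_nat /=.
  by rewrite lerXn2r ?nnegrE //; apply: le_trans bk.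
apply: le_trans (ler_wnM2l _ bK); last by rewrite lecR ltW.
by rewrite -rmorphM -(rmorphN1 (real_complex R)) lecR.
Qed.

End Sufficiency.

(** * Sufficiency in all ranks: induction on the dimension *)

(** The comparison of critical constants for f' and f, term by term; it comes
    from (M + 1) 'C(M, j) = (j + 1) 'C(M + 1, j + 1). *)
Lemma hookdim_deriv N M j :
  (M.+1 * hookdim N M j ^ 2 <= j.+1 * hookdim N.+1 M.+1 j.+1 ^ 2)%N.
Proof.
rewrite /hookdim !subSS; set D := 'C(_, N - j - 1).
have H : (M.+1 * ('C(M, j) * 'C(M, j)) <=
          j.+1 * ('C(M.+1, j.+1) * 'C(M.+1, j.+1)))%N.
  rewrite mulnA (mul_bin_diag M.+1 j) -!mulnA.
  by rewrite leq_mul2l leq_mul2l binS leq_addl !orbT.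
have := leq_mul H (leqnn (D * D)%N).
by congr (_ <= _)%N; rewrite -mulnn; ring.
Qed.

Section PathMonotone.
Variable R : realType.
Notation C := (R[i]).

(** Complex polynomials have no mean value theorem on a real segment; this
    reduces to the real one. *)
Lemma poly_re_im (P : {poly C}) : exists P1 P2 : {poly R},
  P = map_poly (real_complex R) P1 + 'i%C *: map_poly (real_complex R) P2.
Proof.
exists (map_poly (@complex.Re R : Rcomplex R -> R) P),
  (map_poly (@complex.Im R : Rcomplex R -> R) P).
by apply/polyP => k; rewrite coefD coefZ !coef_map /= -complexE.
Qed.

Lemma cpoly_nondecreasing (P : {poly C}) :
  (forall t : R, 0 <= t <= 1 -> 0 <= P^`().[t%:C]) -> P.[0] <= P.[1].
Proof.
have [P1 [P2 ->]] := poly_re_im P; rewrite derivD derivZ !deriv_map => dP.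
have ev (Q1 Q2 : {poly R}) (x : R) :
  (map_poly (real_complex R) Q1 + 'i%C *: map_poly (real_complex R) Q2).[x%:C]
  = Q1.[x] +i* Q2.[x].
  rewrite hornerD hornerZ !horner_map /= [RHS]complexE /=.
  by [].
have dP1 t : t \in `]0, 1[ -> (0 <= P1^`().[t]) /\ P2^`().[t] = 0.
  rewrite in_itv /= => /andP[t0 t1].
  have /dP : 0 <= t <= 1 by rewrite !ltW.
  by rewrite ev lecE /= => /andP[/eqP -> ->].
rewrite -(rmorph0 (real_complex R)) -(rmorph1 (real_complex R)) !ev lecE /=.
have mem (x : R) : 0 <= x -> x <= 1 -> x \in `[0, 1].
  by move=> *; rewrite in_itv /=; apply/andP.
have mono (Q : {poly R}) :
    (forall t, t \in `]0, 1[ -> 0 <= Q^`().[t]) -> Q.[0] <= Q.[1].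
  by move=> dQ; apply: (ler_hornerW dQ); rewrite ?mem.
rewrite (mono P1) ?andbT; last by move=> t /dP1[].
rewrite eq_le (mono P2) ?andbT; last by move=> t /dP1[_ ->].
rewrite -lerN2 -!hornerN mono // => t /dP1[_].
by rewrite derivN hornerN => ->; rewrite oppr0.
Qed.

(** t |-> qform f[B + t D] v is a polynomial in t whose derivative is the
    expression assumed nonnegative; a polynomial replaces the usual integral
    formula for f[B + D] - f[B]. *)
Lemma qform_path n (f : {poly R}) (B D : 'I_n -> 'I_n -> C) (v : 'I_n -> C) :
  (forall t : R, 0 <= t <= 1 -> 0 <= qform (fun i j =>
      D i j * complex_fun f^`() (B i j + t%:C * D i j)) v) ->
  qform (fun i j => complex_fun f (B i j)) v <=
  qform (fun i j => complex_fun f (B i j + D i j)) v.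
Proof.
move=> dpos; pose fC := map_poly (real_complex R) f.
pose P := \sum_i \sum_j
  (v i * Num.conj (v j)) *: (fC \Po ((B i j)%:P + D i j *: 'X)).
have evP x : P.[x] =
    qform (fun i j => complex_fun f (B i j + x * D i j)) v.
  rewrite /P horner_sum; apply: eq_bigr => i _; rewrite horner_sum.
  apply: eq_bigr => j _; rewrite hornerZ horner_comp hornerD hornerC.
  by rewrite hornerZ hornerX /complex_fun [D i j * x]mulrC mulrAC.
have evdP x : P^`().[x] =
    qform (fun i j => D i j * complex_fun f^`() (B i j + x * D i j)) v.
  rewrite /P raddf_sum horner_sum; apply: eq_bigr => i _.
  rewrite raddf_sum horner_sum; apply: eq_bigr => j _ /=.
  rewrite derivZ deriv_comp derivD derivC add0r derivZ derivX /fC deriv_map.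
  rewrite hornerZ hornerM horner_comp hornerD hornerC !hornerZ hornerX hornerC.
  by rewrite /complex_fun [D i j * x]mulrC; ring.
have := @cpoly_nondecreasing P; rewrite !evP.
have -> : qform (fun i j => complex_fun f (B i j + 0 * D i j)) v =
    qform (fun i j => complex_fun f (B i j)) v.
  by apply: eq_bigr => i _; apply: eq_bigr => j _; rewrite mul0r addr0.
have -> : qform (fun i j => complex_fun f (B i j + 1 * D i j)) v =
    qform (fun i j => complex_fun f (B i j + D i j)) v.
  by apply: eq_bigr => i _; apply: eq_bigr => j _; rewrite mul1r.
by apply=> t t01; rewrite evdP dpos.
Qed.

Lemma deriv_poly_of N M (c : 'I_N.+1 -> R) c' :
  (poly_of M.+1 c c')^`() =
  poly_of M (fun j => c (lift ord0 j) *+ j.+1) (c' *+ M.+1).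
Proof.
rewrite /poly_of derivD derivZ derivXn raddf_sum big_ord_recl /=.
rewrite derivZ derivC scaler0 add0r -scalerMnl -scalerMnr; congr (_ + _).
by apply: eq_bigr => j _; rewrite derivZ derivXn -scalerMnl -scalerMnr.
Qed.

Lemma critC_deriv N M (c : 'I_N.+1 -> R) rho : 0 <= rho -> (N <= M)%N ->
  (forall j, 0 < c j) ->
  M.+1%:R * critC M rho (fun j : 'I_N => c (lift ord0 j) *+ j.+1)
    <= critC M.+1 rho c.
Proof.
move=> rho0 NM c0; rewrite !critC_hookdim // mulr_sumr big_ord_recl.
apply: ler_wpDl.
  by rewrite !mulr_ge0 ?exprn_ge0 ?ler0n // invr_ge0 ltW.
apply: ler_sum => j _; have cj := c0 (lift ord0 j).
rewrite [nat_of_ord (lift _ _)]/= /bump leq0n add1n subSS.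
have jn0 : j.+1%:R != 0 :> R by rewrite pnatr_eq0.
have cn0 : c (lift ord0 j) != 0 by rewrite gt_eqF.
set h := (hookdim N M j)%:R; set h' := (hookdim _ _ _)%:R.
have hh' : M.+1%:R * h ^+ 2 <= j.+1%:R * h' ^+ 2 :> R.
  by rewrite -!natrX -!natrM ler_nat hookdim_deriv.
pose e := rho ^+ (M - j) / (c (lift ord0 j) * j.+1%:R).
have e0 : 0 <= e by rewrite divr_ge0 ?exprn_ge0 ?mulr_ge0 ?ler0n // ltW.
have := ler_wpM2l e0 hh'; congr (_ <= _); rewrite /e.
  by rewrite -(mulr_natr (c (lift ord0 j))); field; rewrite nat1r jn0 cn0.
by field; rewrite nat1r jn0 cn0.
Qed.



(** The induction of FitzGerald and Horn. The segment from z z^* to A stays in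
    the set of positive semidefinite kernels with entries bounded by rho because
    this set is convex and |z_i| ^ 2 <= A i i. *)
Theorem psd_kernel_poly_of N m (c : 'I_N -> R) (c' rho : R)
    (A : 'I_N -> 'I_N -> C) :
  0 <= rho -> (forall j, 0 < c j) -> -1 <= c' * critC (m + N) rho c ->
  psd_kernel A -> (forall i j, `|A i j| <= rho%:C) ->
  psd_kernel (fun i j => complex_fun (poly_of (m + N) c c') (A i j)).
Proof.
move=> rho0; elim: N c c' A => [|N IH] c c' A c0 cK pA Arho.
  by split=> [[]|v] //; rewrite /qform big_ord0.
split=> [i j|v]; first by rewrite -complex_fun_conj -(proj1 pA).
have [z [Az pD]] := schur_pivot pA; set D := (fun i j => _ - _) in pD.
have Dc i : D i ord0 = 0 by rewrite /D Az subrr.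
have Dr i : D ord0 i = 0 by rewrite (proj1 pD i ord0) Dc conjC0.
pose B i j := z i * Num.conj (z j).
have BD i j : B i j + D i j = A i j by rewrite /D addrC subrK.
have zrho i : `|z i| ^+ 2 <= rho%:C.
  have Aii := psd_diag_ge0 i pA.
  apply: le_trans (Arho i i); rewrite (ger0_norm Aii) //.
  by move: (psd_diag_ge0 i pD); rewrite /D subr_ge0 -normCK.
have Brho i j : `|B i j| <= rho%:C.
  rewrite normrM norm_conjC -(@ler_pXn2r _ 2) ?nnegrE ?mulr_ge0 ?normr_ge0 ?ler0c //.
  by rewrite exprMn [rho%:C ^+ 2]expr2 ler_pM ?exprn_ge0.
have pB : psd_kernel B by exact: psd_kernel_rank1.
set f := poly_of _ c c'.
have fB : psd_kernel (fun i j => complex_fun f (B i j)).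
  exact: (psd_kernel_rank1_poly rho0 c0 cK zrho).
apply: (le_trans (proj2 fB v)).
have -> : qform (fun i j => complex_fun f (A i j)) v =
    qform (fun i j => complex_fun f (B i j + D i j)) v.
  by apply: eq_bigr => i _; apply: eq_bigr => j _; rewrite BD.
apply: qform_path => t /andP[t0 t1].
rewrite qform_bordered => [|i|i]; rewrite ?Dc ?Dr ?mul0r //.
have tC0 : 0 <= t%:C by rewrite ler0c.
have tC1 : 0 <= 1 - t%:C.
  by rewrite -(rmorph1 (real_complex R)) -rmorphB ler0c subr_ge0.
have BtD i j : B i j + t%:C * D i j = (1 - t%:C) * B i j + t%:C * A i j.
  by rewrite -BD; ring.
have pBt : psd_kernel (fun i j => B i j + t%:C * D i j).
  apply: psd_kernelD => //; exact: psd_kernelZ.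
apply: (proj2 (schur_product (psd_kernel_lift pD) _)).
rewrite /f addnS deriv_poly_of.
apply: (IH _ _ (fun i j => B (lift ord0 i) (lift ord0 j) +
    t%:C * D (lift ord0 i) (lift ord0 j))).
- by move=> j; rewrite mulrn_wgt0.
- have [c'0|c'0] := leP 0 c'.
    apply: (@le_trans _ _ 0); first by rewrite lerN10.
    rewrite mulr_ge0 ?mulrn_wge0 // critC_hookdim ?leq_addl // sumr_ge0 // => j _.
    by rewrite !mulr_ge0 ?exprn_ge0 ?ler0n // invr_ge0 mulrn_wge0 // ltW.
  apply: (le_trans cK); rewrite addnS -mulr_natr -mulrA ler_wnM2l ?(ltW c'0) //.
  by apply: critC_deriv; rewrite ?leq_addl.
- exact: psd_kernel_lift pBt.
move=> i j; rewrite BtD; apply: (le_trans (ler_normD _ _)).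
rewrite (normrM (1 - _)) (normrM t%:C) (ger0_norm tC0) (ger0_norm tC1).
have -> : rho%:C = (1 - t%:C) * rho%:C + t%:C * rho%:C by ring.
by apply: lerD; apply: ler_wpM2l.
Qed.

End PathMonotone.

(** * Necessity *)

Section Necessity.
Variable R : realType.
Notation C := (R[i]).
Implicit Types (p : {poly R}) (rho a b : R).

(** Stands in for the limits where all points tend to one end of the interval. *)
Lemma horner_ge0_endpoints p a b : a < b ->
  (forall x, a < x < b -> 0 <= p.[x]) -> 0 <= p.[a] /\ 0 <= p.[b].
Proof.
move=> ab p0; have close y : a <= y <= b -> 0 <= p.[y].
  move=> /andP[ay yb]; rewrite leNgt; apply/negP => py.
  have [] := @poly_cont R y p (- p.[y]); first by rewrite oppr_gt0.
  move=> d d0 cont.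
  have [x /andP[ax xb] xd] : exists2 x, a < x < b & `|x - y| < d.
    have [yb'|yb'] := ltP y b.
      pose e := Num.min d (b - y) / 2.
      have e0 : 0 < e by rewrite divr_gt0 // lt_min d0 subr_gt0.
      have ed : e + e <= d by rewrite /e -splitr ge_min lexx.
      have eb : e + e <= b - y by rewrite /e -splitr ge_min lexx orbT.
      exists (y + e); first by apply/andP; split; lra.
      by rewrite addrC addKr gtr0_norm //; lra.
    have yE : y = b by apply/eqP; rewrite eq_le yb.
    pose e := Num.min d (b - a) / 2.
    have e0 : 0 < e by rewrite divr_gt0 // lt_min d0 subr_gt0.
    have ed : e + e <= d by rewrite /e -splitr ge_min lexx.
    have eb : e + e <= b - a by rewrite /e -splitr ge_min lexx orbT.
    exists (y - e); first by apply/andP; split; lra.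
    by rewrite addrC addKr normrN gtr0_norm //; lra.
  have px := p0 x _; rewrite ax xb in px; have := cont x xd.
  by rewrite ltr_norml => /andP[_]; have := px isT; lra.
by split; apply: close; rewrite lexx ltW.
Qed.

Lemma distinct_points N a b : a < b ->
  exists2 u : 'I_N -> R, injective u & forall i, a < u i < b.
Proof.
move=> ab; have N0 : 0 < N.+1%:R :> R by rewrite ltr0n.
exists (fun i => a + (b - a) * (i.+1%:R / N.+1%:R)) => [i j|i].
  move/addrI/(mulfI _); rewrite subr_eq0 gt_eqF // => /(_ isT).
  move/(mulIf _); rewrite invr_eq0 gt_eqF // => /(_ isT)/eqP.
  by rewrite eqr_nat => /eqP[]; exact: val_inj.
have q0 : 0 < i.+1%:R / N.+1%:R :> R by rewrite divr_gt0 ?ltr0n.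
have q1 : i.+1%:R / N.+1%:R < 1 :> R by rewrite ltr_pdivrMr // mul1r ltr_nat ltnS.
rewrite ltrDl mulr_gt0 ?subr_gt0 //= -ltrBrDl.
by rewrite gtr_pMr ?subr_gt0.
Qed.

Lemma prescribed_moments N (u w : 'I_N -> R) : injective u ->
  exists v : 'I_N -> R, forall k : 'I_N, \sum_i v i * u i ^+ k = w k.
Proof.
move=> uI; pose V := Vandermonde N (\row_i u i).
have Vu : V \in unitmx.
  rewrite unitmxE unitfE det_Vandermonde; apply/prodf_neq0 => i _.
  apply/prodf_neq0 => j ij; rewrite !mxE subr_eq0.
  by apply: contraTneq ij => /uI ->; rewrite ltnn.
exists (fun i => (invmx V *m \col_k w k) i 0) => k.
have := mulKVmx Vu (\col_k w k) => /matrixP/(_ k 0); rewrite [RHS]mxE => <-.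
by rewrite [RHS]mxE; apply: eq_bigr => i _; rewrite [V k i]mxE !mxE mulrC.
Qed.

Lemma rank1_form_ge0 N p rho (u v : 'I_N -> R) : 0 <= rho ->
  preserves_positivity (complex_fun p)
    (psd_rank1_set (N := N) (real_interval rho)) ->
  (forall i, 0 < u i < Num.sqrt rho) ->
  0 <= \sum_i \sum_j v i * p.[u i * u j] * v j.
Proof.
move=> rho0 pres u_in.
pose A : 'M[C]_N := \matrix_(i, j) (u i * u j)%:C.
have /pres/psdmx_kernel [_ /(_ (fun i => (v i)%:C))] :
    psd_rank1_set (real_interval rho) A.
  split; [split|].
  - apply/psdmx_kernel; apply: eq_psd_kernel (psd_kernel_rank1 (fun i => (u i)%:C)).
    by move=> i j; rewrite mxE conj_real_complex rmorphM.
  - move=> i j; rewrite mxE; exists (u i * u j) => //=.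
    have /andP[ui0 ui] := u_in i; have /andP[uj0 uj] := u_in j.
    rewrite mulr_gt0 //= -(sqr_sqrtr rho0) expr2.
    by rewrite ltr_pM // ltW.
  have -> : A = (\col_i (u i)%:C) *m (\row_i (u i)%:C).
    by apply/matrixP => i j; rewrite !mxE big_ord1 !mxE rmorphM.
  exact: leq_trans (mxrankM_maxl _ _) (rank_leq_col _).
have -> : qform (map_mx (complex_fun p) A) (fun i => (v i)%:C) =
    (\sum_i \sum_j v i * p.[u i * u j] * v j)%:C.
  rewrite rmorph_sum; apply: eq_bigr => i _; rewrite rmorph_sum.
  apply: eq_bigr => j _.
  by rewrite !mxE conj_real_complex /complex_fun horner_map !rmorphM.
by rewrite ler0c.
Qed.

Lemma moment_form_poly_of N M (c u v : 'I_N -> R) c' :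
  \sum_i \sum_j v i * (poly_of M c c').[u i * u j] * v j =
  \sum_(k < N) c k * (\sum_i v i * u i ^+ k) ^+ 2
  + c' * (\sum_i v i * u i ^+ M) ^+ 2.
Proof.
have sqr k : (\sum_i v i * u i ^+ k) ^+ 2 =
    \sum_i \sum_j v i * (u i * u j) ^+ k * v j.
  rewrite expr2 mulr_suml; apply: eq_bigr => i _; rewrite mulr_sumr.
  by apply: eq_bigr => j _; rewrite exprMn; ring.
under [X in _ = X + _]eq_bigr => k _ do rewrite sqr mulr_sumr.
rewrite [X in _ = X + _]exchange_big sqr mulr_sumr -big_split; apply: eq_bigr => i _ /=.
under [X in _ = X + _]eq_bigr => k _ do rewrite mulr_sumr.
rewrite [X in _ = X + _]exchange_big mulr_sumr -big_split; apply: eq_bigr => j _ /=.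
rewrite /poly_of hornerD horner_sum hornerZ hornerXn mulrDr mulrDl.
rewrite mulr_sumr mulr_suml; congr (_ + _); last by ring.
by apply: eq_bigr => k _; rewrite hornerZ hornerXn; ring.
Qed.

Section Form.
Variables (N m : nat) (rho : R) (c : 'I_N -> R) (c' : R).
Hypothesis rho0 : 0 < rho.
Hypothesis pres : preserves_positivity (complex_fun (poly_of (m + N) c c'))
  (psd_rank1_set (N := N) (real_interval rho)).
Let r := Num.sqrt rho.

(** The quadratic form of f[u u^T] in the moments, which are free; the signs of
    the moment relation are absorbed by prescribing (-1) ^ k * w k. *)
Lemma hookp_form_ge0 (u w : 'I_N -> R) : injective u ->
  (forall i, 0 < u i < r) ->
  0 <= \sum_k c k * w k ^+ 2 +
    c' * (\sum_(k < N) (hookp m [seq u i | i <- enum 'I_N])`_k * w k) ^+ 2.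
Proof.
move=> uI u_in.
have sgn2 k : (-1) ^+ k * (-1) ^+ k = 1 :> R.
  by rewrite -exprD addnn -mul2n exprM sqrrN expr1n expr1n.
have [v vw] := prescribed_moments (fun k => (-1) ^+ k * w k) uI.
have := rank1_form_ge0 v (ltW rho0) pres u_in.
rewrite moment_form_poly_of power_sum_hookp; congr (_ <= _ + _ * _).
  by apply: eq_bigr => k _; rewrite vw exprMn [_ ^+ k ^+ 2]sgn2 mul1r.
rewrite exprMn sqrrN [_ ^+ N ^+ 2]sgn2 mul1r; congr (_ ^+ 2).
by apply: eq_bigr => k _; rewrite vw -mulrA [X in _ * X]mulrA sgn2 mul1r.
Qed.

(** Positivity of hook Schur polynomials: all points may be replaced by a
    common lower or upper bound. *)
Lemma hookp_between (u : 'I_N -> R) a b k : 0 <= a -> (k < N)%N ->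
  (forall i, a < u i < b) ->
  let h := (hookp m [seq u i | i <- enum 'I_N])`_k in
  (hookdim N (m + N) k)%:R * a ^+ (m + N - k) <= h /\
  h <= (hookdim N (m + N) k)%:R * b ^+ (m + N - k).
Proof.
move=> a0 kN u_in h.
have sz : size [seq u i | i <- enum 'I_N] = N by rewrite size_map size_enum_ord.
rewrite -!hookp_nseq //; split; apply: le_trans (ler_norm _) _;
  apply: hookp_dominated; rewrite -[X in nseq X _]sz.
  apply: nseq_dominated => // _ /mapP[i _ ->].
  by case/andP: (u_in i) => /ltW.
apply: dominated_nseq => _ /mapP[i _ ->]; have /andP[ai ib] := u_in i.
by rewrite gtr0_norm ?ltW // (le_lt_trans a0).
Qed.

Lemma unit_form (h : 'I_N -> R) (j : 'I_N) :
  \sum_k c k * (k == j)%:R ^+ 2 + c' * (\sum_(k < N) h k * (k == j)%:R) ^+ 2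
  = c j + c' * h j ^+ 2.
Proof.
congr (_ + _ * _ ^+ 2); rewrite (bigD1 j) //= eqxx big1 ?addr0.
- by rewrite expr1n mulr1.
- by move=> k /negPf ->; rewrite expr0n mulr0.
- by rewrite mulr1.
by move=> k /negPf ->; rewrite mulr0.
Qed.

(** The unit vector w = e_j gives c_j + c' h ^ 2 >= 0 for the j-th coefficient h
    of [hookp]. For c' > 0 the points are sent to 0, and h tends to 0 because it
    is homogeneous of degree m + N - j > 0. *)
Lemma preserver_coef_ge0 j : 0 <= c j.
Proof.
have r0 : 0 < r by rewrite sqrtr_gt0.
have bnd x : 0 < x < r ->
    exists2 h, 0 < h <= (hookdim N (m + N) j)%:R * x ^+ (m + N - j)
             & 0 <= c j + c' * h ^+ 2.
  case/andP=> x0 xr; have x2 : x / 2 < x by lra.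
  have x20 : 0 < x / 2 by lra.
  have [u uI u_in] := distinct_points N x2.
  have u_r i : 0 < u i < r.
    by have /andP[] := u_in i => ? ?; apply/andP; split; lra.
  have := hookp_form_ge0 (fun k => (k == j)%:R) uI u_r.
  have [] := hookp_between (ltW x20) (ltn_ord j) u_in.
  rewrite unit_form; set h := _`_j => lo hi form.
  exists h => //; rewrite hi andbT; apply: lt_le_trans lo.
  by rewrite mulr_gt0 ?exprn_gt0 // ltr0n hookdim_gt0 ?leq_addl.
have [c'0|c'0] := leP c' 0.
  have [|h _] := bnd (r / 2); first by apply/andP; split; lra.
  by have := sqr_ge0 h; nra.
pose p : {poly R} := (c j)%:P
  + (c' * (hookdim N (m + N) j)%:R ^+ 2) *: 'X^((m + N - j) * 2).
have pE x : p.[x] = c j + c' * ((hookdim N (m + N) j)%:R * x ^+ (m + N - j)) ^+ 2.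
  by rewrite /p hornerD hornerC hornerZ hornerXn exprM; ring.
have [] := @horner_ge0_endpoints p 0 r r0.
  move=> x /bnd[h /andP[h0 hx] form]; rewrite pE.
  apply: le_trans form _; rewrite lerD2l ler_wpM2l ?(ltW c'0) //.
  by rewrite lerXn2r ?nnegrE ?(le_trans (ltW h0) hx) ?(ltW h0).
rewrite pE expr0n; have -> : (m + N - j == 0)%N = false.
  by have := ltn_ord j; lia.
by rewrite mulr0 expr0n mulr0 addr0.
Qed.

(** Now c_j >= - c' h ^ 2 with h > 0 at positive points. *)
Lemma preserver_coef_gt0 j : c' < 0 -> 0 < c j.
Proof.
move=> c'0; have r0 : 0 < r by rewrite sqrtr_gt0.
have r2 : r / 2 < r by lra.
have r20 : 0 < r / 2 by lra.
have [u uI u_in] := distinct_points N r2.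
have u_r i : 0 < u i < r.
  by have /andP[] := u_in i => ? ?; apply/andP; split; lra.
have := hookp_form_ge0 (fun k => (k == j)%:R) uI u_r.
have [] := hookp_between (ltW r20) (ltn_ord j) u_in.
rewrite unit_form; set h := _`_j => lo hi form.
have h0 : 0 < h.
  apply: lt_le_trans lo.
  by rewrite mulr_gt0 ?exprn_gt0 // ltr0n hookdim_gt0 ?leq_addl.
by have : 0 < h ^+ 2 by [rewrite exprn_gt0]; nra.
Qed.

(** At w_k = h_k / c_k the form equals D (1 + c' D) with D = sum_k h_k ^ 2 / c_k;
    this is the equality case of Cauchy-Schwarz. Points above x make D at least
    the critical constant for x ^ 2, and x then tends to sqrt rho. *)
Lemma preserver_critC_bound : (0 < N)%N -> c' < 0 -> 0 <= 1 + c' * critC (m + N) rho c.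
Proof.
move=> N0 c'0; have r0 : 0 < r by rewrite sqrtr_gt0.
have c0 j : 0 < c j by exact: preserver_coef_gt0.
pose S k : R := (hookdim N (m + N) k)%:R.
pose p : {poly R} := 1 + c' *: \sum_(k < N) (S k ^+ 2 / c k) *: 'X^(2 * (m + N - k)).
have pE x : p.[x] = 1 + c' * \sum_(k < N) (S k * x ^+ (m + N - k)) ^+ 2 / c k.
  rewrite /p hornerD hornerC hornerZ horner_sum; congr (_ + _ * _).
  by apply: eq_bigr => k _; rewrite hornerZ hornerXn mulnC exprM; ring.
have [] := @horner_ge0_endpoints p 0 r r0; last first.
  move=> _; rewrite pE critC_hookdim ?leq_addl //.
  congr (_ <= _ + _ * _); apply: eq_bigr => k _.
  by rewrite exprMn exprAC sqr_sqrtr ?ltW.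
move=> x /andP[x0 xr]; rewrite pE.
have [u uI u_in] := distinct_points N xr.
have u_r i : 0 < u i < r.
  by have /andP[xu ur] := u_in i; rewrite ur (lt_trans x0 xu).
set h := hookp m [seq u i | i <- enum 'I_N].
pose D := \sum_(k < N) h`_k ^+ 2 / c k.
have := hookp_form_ge0 (fun k => h`_k / c k) uI u_r; rewrite -/h.
have -> : \sum_(k < N) c k * (h`_k / c k) ^+ 2 = D.
  apply: eq_bigr => k _; field; by rewrite gt_eqF.
have -> : \sum_(k < N) h`_k * (h`_k / c k) = D.
  by apply: eq_bigr => k _; rewrite mulrA.
have lo (k : 'I_N) : 0 < S k * x ^+ (m + N - k) <= h`_k.
  have [lo _] := hookp_between (ltW x0) (ltn_ord k) u_in.
  by rewrite lo andbT mulr_gt0 ?exprn_gt0 // ltr0n hookdim_gt0 ?leq_addl.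
set K := \sum_(k < N) _; have KD : K <= D.
  apply: ler_sum => k _; have /andP[l0 l1] := lo k.
  by rewrite ler_pM2r ?invr_gt0 // lerXn2r ?nnegrE ?(ltW l0) ?(le_trans (ltW l0)).
have K0 : 0 < K.
  rewrite /K (bigD1 (Ordinal N0)) //= ltr_wpDr //.
    by apply: sumr_ge0 => k _; rewrite divr_ge0 ?sqr_ge0 // ltW.
  by have /andP[l0 _] := lo (Ordinal N0); rewrite divr_gt0 // exprn_gt0.
have D0 : 0 < D by exact: lt_le_trans K0 KD.
have -> : D + c' * D ^+ 2 = D * (1 + c' * D) by ring.
rewrite pmulr_rge0 // => /le_trans; apply; rewrite lerD2l.
by rewrite ler_wnM2l // ltW.
Qed.

End Form.

Lemma critC_gt0 N M rho (c : 'I_N -> R) : (0 < N)%N -> (N <= M)%N -> 0 < rho ->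
  (forall j, 0 < c j) -> 0 < critC M rho c.
Proof.
move=> N0 NM rho0 c0; rewrite critC_hookdim // (bigD1 (Ordinal N0)) //=.
rewrite ltr_wpDr //.
  apply: sumr_ge0 => k _.
  by rewrite !mulr_ge0 ?exprn_ge0 ?ler0n ?invr_ge0 // ltW.
by rewrite divr_gt0 // mulr_gt0 ?exprn_gt0 // ltr0n hookdim_gt0.
Qed.

Lemma coef_poly_of N M (c : 'I_N -> R) c' k :
  (poly_of M c c')`_k = \sum_(j < N) c j * (k == j)%:R + c' * (k == M)%:R.
Proof.
rewrite /poly_of coefD coef_sum coefZ coefXn; congr (_ + _).
by apply: eq_bigr => j _; rewrite coefZ coefXn.
Qed.

(** Puts a polynomial of degree less than N in the form treated above, with
    m = 0 and c' = 0. *)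
Lemma poly_of_coef N M (c : 'I_N -> R) c' : (M < N)%N ->
  poly_of M c c' = poly_of (0 + N) (fun k : 'I_N => (poly_of M c c')`_k) 0.
Proof.
move=> MN; rewrite [RHS]/poly_of scale0r addr0 -poly_def.
apply/polyP => k; rewrite coef_poly; case: ltnP => // Nk.
rewrite coef_poly_of big1 ?add0r => [|j _].
  by rewrite gtn_eqF ?mulr0 // (leq_trans MN).
by rewrite gtn_eqF ?mulr0 // (leq_trans (ltn_ord j)).
Qed.

Lemma poly_of_ge0 N M (c : 'I_N -> R) c' k : 
  (forall j, 0 <= c j) -> 0 <= c' -> 0 <= (poly_of M c c')`_k.
Proof.
move=> c0 c'0; rewrite coef_poly_of addr_ge0 ?mulr_ge0 // sumr_ge0 // => j _.
by rewrite mulr_ge0.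
Qed.


Lemma coef_cond_preserves N M rho (c : 'I_N -> R) c' : 0 < rho -> (0 < N)%N ->
  coef_cond M rho c c' \/ ((M < N)%N /\ forall k : nat, 0 <= (poly_of M c c')`_k) ->
  preserves_positivity (complex_fun (poly_of M c c'))
    (psd_set (N := N) (closed_disc rho)).
Proof.
move=> rho0 N0 cond A [/psdmx_kernel pA Arho]; apply/psdmx_kernel.
suff pf : psd_kernel (fun i j => complex_fun (poly_of M c c') (A i j)).
  by apply: eq_psd_kernel pf => i j; rewrite mxE.
case: cond => [[[c0 c'0]|[c0 c'C]]|[_ f0]]; last exact: psd_kernel_nonneg_coef.
  by apply: psd_kernel_nonneg_coef => // k; exact: poly_of_ge0.
have [MN|NM] := ltnP M N.
  apply: psd_kernel_nonneg_coef => // k; rewrite coef_poly_of.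
  rewrite (critC_small _ _ MN) invrK in c'C.
  have [->|kM] := eqVneq k M; last first.
    rewrite mulr0 addr0 sumr_ge0 // => j _.
    by rewrite mulr_ge0 ?ler0n // ltW.
  rewrite (bigD1 (Ordinal MN)) //= eqxx !mulr1 addrAC addr_ge0 //.
    by rewrite -lerBlDl sub0r.
  by rewrite sumr_ge0 // => j _; rewrite mulr_ge0 ?ler0n // ltW.
have C0 := critC_gt0 N0 NM rho0 c0; rewrite -(subnK NM) in c'C C0 *.
apply: (psd_kernel_poly_of (ltW rho0)) => //.
by rewrite -ler_pdivrMr // mulN1r.
Qed.

Lemma preserves_coef_cond N M rho (c : 'I_N -> R) c' : 0 < rho -> (0 < N)%N ->
  preserves_positivity (complex_fun (poly_of M c c'))
    (psd_rank1_set (N := N) (real_interval rho)) ->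
  coef_cond M rho c c' \/ ((M < N)%N /\ forall k : nat, 0 <= (poly_of M c c')`_k).
Proof.
move=> rho0 N0 pres; have [MN|NM] := ltnP M N.
  right; split=> // k; move: pres; rewrite (poly_of_coef _ _ MN) => pres.
  by apply: poly_of_ge0 => // j; exact: (preserver_coef_ge0 rho0 pres).
left; rewrite -(subnK NM) in pres *; set m := (M - N)%N in pres *.
have [c'0|c'0] := leP 0 c'; [left|right].
  by split=> // j; exact: (preserver_coef_ge0 rho0 pres).
have c0 j : 0 < c j by exact: (preserver_coef_gt0 rho0 pres).
split=> //; have C0 := critC_gt0 N0 (leq_addl m N) rho0 c0.
have bnd := preserver_critC_bound rho0 pres N0 c'0.
by rewrite -(ler_pM2r C0) mulNr mulVf ?gt_eqF // -subr_ge0 opprK addrC.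
Qed.

Lemma rank1_sub_disc N rho :
  (psd_rank1_set (N := N) (real_interval rho) `<=` psd_set (closed_disc rho))%classic.
Proof.
move=> A [[pA Ain] _]; split=> // i j; have [x /andP[x0 xr] <-] := Ain i j.
by rewrite /closed_disc /= ger0_norm ?ler0c ?lecR // ltW.
Qed.

End Necessity.

Theorem theorem1p1 (R : realType) (rho : R) (N M : nat) (c : 'I_N -> R)
    (c' : R) :
  (0 < rho)%R -> (0 < N)%N ->
  [<-> preserves_positivity (complex_fun (poly_of M c c'))
         (psd_set (N := N) (closed_disc rho));
       coef_cond M rho c c'
         \/ ((M < N)%N /\ forall k : nat, (0 <= (poly_of M c c')`_k)%R);
       preserves_positivity (complex_fun (poly_of M c c'))
         (psd_rank1_set (N := N) (real_interval rho))].
Proof.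
move=> rho0 N0.
have restrict : preserves_positivity (complex_fun (poly_of M c c'))
    (psd_set (N := N) (closed_disc rho)) ->
  preserves_positivity (complex_fun (poly_of M c c'))
    (psd_rank1_set (N := N) (real_interval rho)).
  by move=> pres A /rank1_sub_disc; exact: pres.
split; [|split].
- by move/restrict; exact: preserves_coef_cond.
- by move/(coef_cond_preserves rho0 N0)/restrict.
by move/(preserves_coef_cond rho0 N0); exact: coef_cond_preserves.
Qed.
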